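(* Let $R$ be a commutative Noetherian ring with unity and let $k\in\mathbb{N}$. The category of finitely generated ($\mathbb{N}^k$-)graded $R[\mathbb{N}^k]$-modules is isomorphic to the category of (generalized) algebraic persistence modules over $R$ indexed by $\mathbb{N}^k$ of finitely generated type.
   Context: $\mathbb{N}=\{0,1,2,\dots\}$. Let $G=(\mathbb{N}^k,+)$ with componentwise addition, and write $g_1\preceq g_2$ if there is $h\in G$ with $h+g_1=g_2$. The monoid ring $R[G]$ is the free $R$-module with basis $\{X^g\}_{g\in G}$ and multiplication determined by $X^{g_1}X^{g_2}=X^{g_1+g_2}$ (so $R[\mathbb{N}^k]\cong R[t_1,\dots,t_k]$); it is $G$-graded with $R[G]_g=RX^g$. A $G$-graded $R[G]$-module is an $R[G]$-module $M$ with a decomposition $M=\bigoplus_{g\in G}M_g$ into abelian groups with $R[G]_{g_1}M_{g_2}\subseteq M_{g_1+g_2}$ for all $g_1,g_2$. A $G$-graded morphism is a module morphism $f:M\to N$ with $f(M_g)\subseteq N_g$ for all $g$. A generalized algebraic persistence module (GAPM) over $R$ indexed by $G$ is a tuple $\mathcal{M}_G=((M_g)_{g\in G},(\varphi_{g_1,g_2})_{g_1\preceq g_2\in G})$ where each $M_g$ is an $R$-module, each $\varphi_{g_1,g_2}:M_{g_1}\to M_{g_2}$ is an $R$-module morphism, $\varphi_{g,g}=1_{M_g}$, and $\varphi_{g_1,g_3}=\varphi_{g_2,g_3}\circ\varphi_{g_1,g_2}$ for all $g_1\preceq g_2\preceq g_3$. A GAPM morphism from $((M_g),(\varphi_{g_1,g_2}))$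 to $((N_g),(\psi_{g_1,g_2}))$ is a family $(\xi_g:M_g\to N_g)_{g\in G}$ of $R$-module morphisms with $\psi_{g_1,g_2}\circ\xi_{g_1}=\xi_{g_2}\circ\varphi_{g_1,g_2}$ for all $g_1\preceq g_2$. For $g\in G$, an element $h\in G$ is a frame of $g$ (with respect to $\mathcal{M}_G$) if $h\preceq g$ and $\varphi_{h,\tilde g}$ is an isomorphism for all $\tilde g$ with $h\preceq\tilde g\preceq g$. A subset $H\subseteq G$ is a framing set of $\mathcal{M}_G$ if every $g\in G$ has a frame in $H$. $\mathcal{M}_G$ is of finite type if it has a finite framing set, and of finitely generated type if in addition every $M_g$ is finitely generated as an $R$-module. The two categories in the claim are the full subcategories, on the indicated objects, of the category of $G$-graded $R[G]$-modules with $G$-graded morphisms and of the category of GAPMs over $R$ indexed by $G$ with GAPM morphisms. Two categories are isomorphic if there are functors in both directions whose two compositions are the identity functors. *)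

(* Defs.v *)
From HB Require Import structures.
From mathcomp Require Import all_boot all_order all_algebra.
From mathcomp Require Import boolp classical_sets functions cardinality fsbigop.

Set Implicit Arguments.
Unset Strict Implicit.
Unset Printing Implicit Defensive.

Import GRing.Theory.

Local Open Scope classical_set_scope.
Local Open Scope ring_scope.

Section DirectSum.
Variables (I : choiceType) (M : I -> zmodType).

Record dsum := DSum {
  dsum_val :> forall i, M i;
  dsum_fin : finite_set [set i | dsum_val i != 0]
}.

Lemma dsumP (x y : dsum) : (forall i, x i = y i) -> x = y.
Proof.
case: x y => [f ff] [g gf] /= fg.
have {}fg : f = g by apply: functional_extensionality_dep.
by case: _ / fg gf => gf; congr DSum; apply: Prop_irrelevance.
Qed.

HB.instance Definition _ := gen_eqMixin dsum.
HB.instance Definition _ := gen_choiceMixin dsum.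

Fact dsum0_fin : finite_set [set i | (0 : M i) != 0].
Proof. by apply: (sub_finite_set _ (finite_set0 I)) => i /=; rewrite eqxx. Qed.
Definition dsum0 := @DSum (fun i => 0) dsum0_fin.

Fact dsumN_fin (x : dsum) : finite_set [set i | - x i != 0].
Proof.
by apply: (sub_finite_set _ (dsum_fin x)) => i /=; rewrite oppr_eq0.
Qed.
Definition dsumN x := DSum (dsumN_fin x).

Fact dsumD_fin (x y : dsum) : finite_set [set i | x i + y i != 0].
Proof.
have fxy : finite_set ([set i | x i != 0] `|` [set i | y i != 0]).
  by rewrite finite_setU; split; apply: dsum_fin.
apply: (sub_finite_set _ fxy) => i /= xy0.
have [xi0|] := eqVneq (x i) 0; last by left.
by right; move: xy0; rewrite xi0 add0r.
Qed.
Definition dsumD x y := DSum (dsumD_fin x y).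

Fact dsumDA : associative dsumD.
Proof. by move=> x y z; apply: dsumP => i /=; rewrite addrA. Qed.
Fact dsumDC : commutative dsumD.
Proof. by move=> x y; apply: dsumP => i /=; rewrite addrC. Qed.
Fact dsum0D : left_id dsum0 dsumD.
Proof. by move=> x; apply: dsumP => i /=; rewrite add0r. Qed.
Fact dsumND : left_inverse dsum0 dsumN dsumD.
Proof. by move=> x; apply: dsumP => i /=; rewrite addNr. Qed.

HB.instance Definition _ := GRing.isZmodule.Build dsum
  dsumDA dsumDC dsum0D dsumND.

Definition summand (i : I) : set dsum := [set x | forall j, j != i -> x j = 0].

Fact dsum_inj_fin i (m : M i) :
  finite_set [set j | dfwith (fun j => 0 : M j) m j != 0].
Proof.
apply: (sub_finite_set _ (finite_set1 i)) => j /=.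
by case: dfwithP => // k _; rewrite eqxx.
Qed.
Definition dsum_inj i (m : M i) : dsum := DSum (dsum_inj_fin m).

Definition dsum_lift (V : zmodType) (F : forall i, M i -> V) (x : dsum) : V :=
  \sum_(i \in setT) F i (x i).

Lemma dsum_inj_in i (m : M i) : dsum_inj m i = m.
Proof. by rewrite /= dfwith_in. Qed.

Lemma dsum_inj_out i (m : M i) j : i != j -> dsum_inj m j = 0.
Proof. by move=> ij; rewrite /= dfwith_out. Qed.

Lemma dsum_injD i (m n : M i) : dsum_inj (m + n) = dsum_inj m + dsum_inj n.
Proof.
apply: dsumP => j; change (dsum_inj (m + n) j = dsum_inj m j + dsum_inj n j).
have [->|ij] := eqVneq j i; first by rewrite !dsum_inj_in.
by rewrite !dsum_inj_out 1?eq_sym // addr0.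
Qed.

Section Lift.
Variables (V : zmodType) (F : forall i, M i -> V).
Hypothesis FD : forall i (m n : M i), F (m + n) = F m + F n.

Let F0 i : F (0 : M i) = 0.
Proof. by apply: (addrI (F (0 : M i))); rewrite -FD !addr0. Qed.

Lemma dsum_lift_widen (A : set I) (x : dsum) :
  [set i | x i != 0] `<=` A -> dsum_lift F x = \sum_(i \in A) F (x i).
Proof.
move=> xA; rewrite /dsum_lift; apply/esym/fsbig_widen => // i [_ /= iA].
by case: (eqVneq (x i) 0) => [->//|/xA].
Qed.

Lemma dsum_liftD x y : dsum_lift F (x + y) = dsum_lift F x + dsum_lift F y.
Proof.
pose A := [set i | x i != 0] `|` [set i | y i != 0].
have fA : finite_set A by rewrite finite_setU; split; apply: dsum_fin.
rewrite !(@dsum_lift_widen A) => [|i xi|i xi|i /= xyi]; last 1 first.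
- have [xi0|] := eqVneq (x i) 0; last by left.
  by right; move: xyi; rewrite /= xi0 add0r.
- rewrite -fsbig_split //; apply: eq_fsbigr => i _ /=; exact: FD.
- by right.
- by left.
Qed.

Lemma dsum_lift_inj i (m : M i) : dsum_lift F (dsum_inj m) = F m.
Proof.
rewrite (@dsum_lift_widen [set i]) => [|j /=].
  by rewrite fsbig_set1 dsum_inj_in.
by case: dfwithP => // k _; rewrite eqxx.
Qed.

End Lift.

Lemma dsum_ind (P : dsum -> Prop) :
  P 0 -> (forall x y, P x -> P y -> P (x + y)) ->
  (forall i (m : M i), P (dsum_inj m)) -> forall x, P x.
Proof.
move=> P0 PD Pi x.
have -> : x = dsum_lift dsum_inj x.
  apply: dsumP => i.
  have ciD (y z : dsum) : (y + z) i = y i + z i by [].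
  have [s us sx] : exists2 s : seq I, uniq s & [set` s] = [set i | x i != 0].
    have /finite_seqP[s sE] := dsum_fin x; exists (undup s).
      exact: undup_uniq.
    by rewrite sE; apply/seteqP; split=> j; rewrite /= mem_undup.
  rewrite (@dsum_lift_widen _ _ dsum_injD [set` s]) ?sx// -sx -fsbig_seq//.
  have bigE : (\sum_(j <- s) dsum_inj (x j)) i
            = \sum_(j <- s) (dsum_inj (x j)) i.
    exact: (big_morph (fun y : dsum => y i) ciD erefl).
  rewrite bigE; have [si|nsi] := boolP (i \in s).
    rewrite (bigD1_seq i)//= dfwith_in big1_seq ?addr0// => j /andP[ji _].
    by rewrite dfwith_out.
  rewrite big1_seq => [|j /andP[_ js]].
    apply/eqP; apply: contraNT nsi => xi.
    suff : [set` s] i by [].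
    by rewrite sx.
  by rewrite dsum_inj_out//; apply: contraNneq nsi => <-.
rewrite /dsum_lift; elim/big_ind: _ => //.
Qed.

End DirectSum.

Arguments summand {I M}.

(* The monoid ring R[G] of a commutative monoid G.  The library's {malg R[G]} *)
(* and {mpoly R[k]} require 1 != 0 in R, which is not assumed here.           *)

Section MonoidRing.
Variables (R : comPzRingType) (G : nmodType).

Definition monoid_ring := dsum (fun _ : G => R).
HB.instance Definition _ := GRing.Zmodule.on monoid_ring.

(* The element r X^g *)
Definition monom (r : R) (g : G) : monoid_ring :=
  dsum_inj (M := fun=> R) (i := g) r.

(* The biadditive extension of (r X^g) (s X^h) = (r s) X^(g + h) *)
Definition mr_mul (p q : monoid_ring) : monoid_ring :=
  dsum_lift (fun g (r : R) =>
    dsum_lift (fun h (s : R) => monom (r * s) (g + h)) q) p.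

Lemma monomD r s g : monom (r + s) g = monom r g + monom s g.
Proof. exact: dsum_injD. Qed.

Fact mr_mul_aux r g : {morph (fun q : monoid_ring =>
  dsum_lift (fun h (s : R) => monom (r * s) (g + h)) q) : x y / x + y}.
Proof. by move=> x y; apply: dsum_liftD => h m n; rewrite mulrDr monomD. Qed.

Fact mr_mul_aux2 (q : monoid_ring) g : {morph (fun r : R =>
  dsum_lift (fun h (s : R) => monom (r * s) (g + h)) q) : x y / x + y}.
Proof.
move=> x y; elim/dsum_ind: q => [|a b ha hb|h s].
- suff E r : dsum_lift (fun h (s : R) => monom (r * s) (g + h)) 0 = 0.
    by rewrite !E addr0.
  by apply: (addrI (dsum_lift (fun h (s : R) => monom (r * s) (g + h)) 0));
     rewrite -mr_mul_aux !addr0.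
- by rewrite !mr_mul_aux ha hb addrACA.
- rewrite !dsum_lift_inj; first by rewrite mulrDl monomD.
  all: by move=> i m n; rewrite mulrDr monomD.
Qed.

Fact mr_mulDl : left_distributive mr_mul +%R.
Proof. by move=> x y z; apply: dsum_liftD => g; apply: mr_mul_aux2. Qed.

Fact mr_mul0l q : mr_mul 0 q = 0.
Proof. by apply: (addrI (mr_mul 0 q)); rewrite -mr_mulDl !addr0. Qed.

Fact mr_mulE r s g h : mr_mul (monom r g) (monom s h) = monom (r * s) (g + h).
Proof.
rewrite /mr_mul dsum_lift_inj => [|i]; last exact: mr_mul_aux2.
by rewrite dsum_lift_inj// => i m n; rewrite mulrDr monomD.
Qed.

Fact mr_mulDr : right_distributive mr_mul +%R.
Proof.
move=> x y z; elim/dsum_ind: x => [|a b ha hb|g r].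
- by rewrite !mr_mul0l addr0.
- by rewrite !mr_mulDl ha hb addrACA.
- by rewrite /mr_mul !dsum_lift_inj ?mr_mul_aux// => i; apply: mr_mul_aux2.
Qed.

Fact mr_mul0r q : mr_mul q 0 = 0.
Proof. by apply: (addrI (mr_mul q 0)); rewrite -mr_mulDr !addr0. Qed.

Fact mr_mulC : commutative mr_mul.
Proof.
move=> p q; elim/dsum_ind: p => [|a b ha hb|g r].
- by rewrite mr_mul0l mr_mul0r.
- by rewrite mr_mulDl mr_mulDr ha hb.
elim/dsum_ind: q => [|a b ha hb|h s].
- by rewrite mr_mul0l mr_mul0r.
- by rewrite mr_mulDl mr_mulDr ha hb.
- by rewrite !mr_mulE mulrC addrC.
Qed.

Fact mr_mulA : associative mr_mul.
Proof.
move=> p q u; elim/dsum_ind: p => [|a b ha hb|g r].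
- by rewrite !mr_mul0l.
- by rewrite !mr_mulDl ha hb.
elim/dsum_ind: q => [|a b ha hb|h s].
- by rewrite mr_mul0r !mr_mul0l mr_mul0r.
- by rewrite !(mr_mulDl, mr_mulDr) ha hb.
elim/dsum_ind: u => [|a b ha hb|l t].
- by rewrite !mr_mul0r.
- by rewrite !mr_mulDr ha hb.
- by rewrite !mr_mulE mulrA addrA.
Qed.

Fact mr_mul1 : left_id (monom 1 0) mr_mul.
Proof.
move=> p; elim/dsum_ind: p => [|a b ha hb|g r].
- by rewrite mr_mul0r.
- by rewrite mr_mulDr ha hb.
- by rewrite mr_mulE mul1r add0r.
Qed.

HB.instance Definition _ := GRing.Zmodule_isComPzRing.Build monoid_ring
  mr_mulA mr_mulC mr_mul1 mr_mulDl.

Lemma monomM r s g h : monom r g * monom s h = monom (r * s) (g + h).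
Proof. exact: mr_mulE. Qed.

End MonoidRing.

Definition fin_generated (S : pzRingType) (V : lmodType S) : Prop :=
  exists n (v : 'I_n -> V), forall x : V,
  exists c : 'I_n -> S, x = \sum_(i < n) c i *: v i.

Definition is_ideal (R : comPzRingType) (J : set R) : Prop :=
  [/\ J 0, forall x y, J x -> J y -> J (x + y) & forall a x, J x -> J (a * x)].

Definition noetherian (R : comPzRingType) : Prop :=
  forall J : set R, is_ideal J ->
  exists n (v : 'I_n -> R), (forall i, J (v i)) /\
  forall x, J x -> exists c : 'I_n -> R, x = \sum_(i < n) c i * v i.

Record category := Category {
  obj :> Type;
  hom : obj -> obj -> Type;
  idm : forall a, hom a a;
  comp : forall a b c, hom b c -> hom a b -> hom a c;
  comp_idl : forall a b (f : hom a b), comp (idm b) f = f;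
  comp_idr : forall a b (f : hom a b), comp f (idm a) = f;
  comp_assoc : forall a b c d (f : hom c d) (g : hom b c) (h : hom a b),
    comp f (comp g h) = comp (comp f g) h
}.

Arguments hom {c} : rename.
Arguments idm {c} : rename.
Arguments comp {c a b} [_] : rename.

Record functor (C D : category) := Functor {
  fobj :> C -> D;
  fmap : forall a b : C, hom a b -> hom (fobj a) (fobj b);
  fmap_id : forall a, fmap (idm a) = idm (fobj a);
  fmap_comp : forall a b c (f : hom b c) (g : hom a b),
    fmap (comp f g) = comp (fmap f) (fmap g)
}.

Arguments fmap {C D} f {a b} : rename.

Definition functor_id (C : category) : functor C C :=
  @Functor C C id (fun _ _ f => f) (fun=> erefl) (fun _ _ _ _ _ => erefl).

Section FunctorComp.
Variables (B C D : category) (F : functor C D) (E : functor B C).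

Fact functor_comp_id a : fmap F (fmap E (idm a)) = idm (F (E a)).
Proof. by rewrite !fmap_id. Qed.

Fact functor_comp_comp a b c (f : hom b c) (g : hom a b) :
  fmap F (fmap E (comp f g)) = comp (fmap F (fmap E f)) (fmap F (fmap E g)).
Proof. by rewrite !fmap_comp. Qed.

Definition functor_comp : functor B D :=
  @Functor B D (fun a => F (E a)) (fun _ _ f => fmap F (fmap E f))
    functor_comp_id functor_comp_comp.

End FunctorComp.

Definition isomorphic (C D : category) : Prop :=
  exists (F : functor C D) (E : functor D C),
    functor_comp E F = functor_id C /\ functor_comp F E = functor_id D.

Definition full_subcategory (C : category) (P : C -> Prop) : category :=
  @Category {a : C | P a} (fun a b => hom (sval a) (sval b))
    (fun a => idm (sval a)) (fun _ _ _ f g => comp f g)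
    (fun _ _ f => comp_idl f) (fun _ _ f => comp_idr f)
    (fun _ _ _ _ f g h => comp_assoc f g h).

Lemma linear_eqP (S : pzRingType) (U V : lmodType S) (f g : {linear U -> V}) :
  (forall x, f x = g x) -> f = g.
Proof.
case: f g => [f [[af] [sf]]] [g [[ag] [sg]]] /= fg.
have {}fg : f = g by apply: functional_extensionality_dep.
case: _ / fg ag sg => ag sg.
by rewrite (Prop_irrelevance af ag) (Prop_irrelevance sf sg).
Qed.

Section GradedModules.
Variables (R : comPzRingType) (G : nmodType).
Local Notation RG := (monoid_ring R G).

Definition dsum_lmod (M : G -> zmodType)
  (s : GRing.Zmodule_isLmodule RG (dsum M)) : lmodType RG :=
  HB.pack (dsum M) s.

(* The decomposition of a graded module is an external direct sum: a graded   *)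
(* module is a family of abelian groups together with an R[G]-module          *)
(* structure on their direct sum.  With an arbitrary carrier decomposed       *)
(* internally, the category would only be equivalent to this one, and not     *)
(* isomorphic to that of persistence modules, since no construction on the    *)
(* homogeneous components recovers the carrier on the nose.                   *)
Record gradedModule := GradedModule {
  gr_comp : G -> zmodType;
  gr_struct : GRing.Zmodule_isLmodule RG (dsum gr_comp);
  gr_graded : forall (g1 g2 : G) (r : R) (m : dsum_lmod gr_struct),
    summand g2 m -> summand (g1 + g2) (monom r g1 *: m)
}.

Definition gr_tot (M : gradedModule) : lmodType RG := dsum_lmod (gr_struct M).

Record gr_hom (M N : gradedModule) := GrHom {
  gr_fun :> {linear gr_tot M -> gr_tot N};
  gr_funP : forall g (m : gr_tot M), summand g m -> summand g (gr_fun m)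
}.

Lemma gr_homP M N (f f' : gr_hom M N) : (forall x, f x = f' x) -> f = f'.
Proof.
case: f f' => [f pf] [f' pf'] /= fx.
have ff' : f = f' by apply: linear_eqP.
by case: _ / ff' pf' => pf'; congr GrHom; apply: Prop_irrelevance.
Qed.

Definition gr_id M : gr_hom M M :=
  @GrHom M M (idfun : {linear gr_tot M -> gr_tot M}) (fun _ _ h => h).

Definition gr_compose M N P (f : gr_hom N P) (h : gr_hom M N) : gr_hom M P :=
  @GrHom M P (f \o h : {linear gr_tot M -> gr_tot P})
    (fun _ _ hm => gr_funP f (gr_funP h hm)).

Fact gr_idl M N (f : gr_hom M N) : gr_compose (@gr_id N) f = f.
Proof. exact: gr_homP. Qed.

Fact gr_idr M N (f : gr_hom M N) : gr_compose f (@gr_id M) = f.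
Proof. exact: gr_homP. Qed.

Fact gr_assoc M N P Q (f : gr_hom P Q) (g : gr_hom N P)
    (h : gr_hom M N) :
  gr_compose f (gr_compose g h) = gr_compose (gr_compose f g) h.
Proof. exact: gr_homP. Qed.

Definition gradedCat : category := Category gr_idl gr_idr gr_assoc.

Definition gr_fin_generated (M : gradedCat) : Prop := fin_generated (gr_tot M).

End GradedModules.

Section PersistenceModules.
Variables (R : comPzRingType) (G : nmodType).

Definition preceq (g1 g2 : G) : Prop := exists h, h + g1 = g2.
Local Infix "⪯" := preceq (at level 70).

Record gapm := Gapm {
  pm_comp : G -> lmodType R;
  pm_map : forall g1 g2, g1 ⪯ g2 -> {linear pm_comp g1 -> pm_comp g2};
  pm_map_id : forall g (le_gg : g ⪯ g) x, pm_map le_gg x = x;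
  pm_map_comp : forall g1 g2 g3 (le12 : g1 ⪯ g2) (le23 : g2 ⪯ g3)
    (le13 : g1 ⪯ g3) x, pm_map le13 x = pm_map le23 (pm_map le12 x)
}.

Record gapm_hom (M N : gapm) := GapmHom {
  pm_fun :> forall g, {linear pm_comp M g -> pm_comp N g};
  pm_funP : forall g1 g2 (le12 : g1 ⪯ g2) x,
    pm_map N le12 (pm_fun g1 x) = pm_fun g2 (pm_map M le12 x)
}.

Lemma gapm_homP M N (f f' : gapm_hom M N) :
  (forall g x, f g x = f' g x) -> f = f'.
Proof.
case: f f' => [f pf] [f' pf'] /= ff'.
have {}ff' : f = f'.
  by apply: functional_extensionality_dep => g; apply: linear_eqP => x; apply: ff'.
by case: _ / ff' pf' => pf'; congr GapmHom; apply: Prop_irrelevance.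
Qed.

Definition gapm_id M : gapm_hom M M :=
  @GapmHom M M (fun g => (idfun : {linear pm_comp M g -> pm_comp M g}))
    (fun _ _ _ _ => erefl).

Fact gapm_compose_subproof M N P (f : gapm_hom N P) (h : gapm_hom M N)
  g1 g2 (le12 : g1 ⪯ g2) x :
  pm_map P le12 (f g1 (h g1 x)) = f g2 (h g2 (pm_map M le12 x)).
Proof. by rewrite !pm_funP. Qed.

Definition gapm_compose M N P (f : gapm_hom N P) (h : gapm_hom M N) :
    gapm_hom M P :=
  @GapmHom M P (fun g => (f g \o h g : {linear pm_comp M g -> pm_comp P g}))
    (gapm_compose_subproof f h).

Fact gapm_idl M N (f : gapm_hom M N) : gapm_compose (@gapm_id N) f = f.
Proof. exact: gapm_homP. Qed.

Fact gapm_idr M N (f : gapm_hom M N) : gapm_compose f (@gapm_id M) = f.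
Proof. exact: gapm_homP. Qed.

Fact gapm_assoc M N P Q (f : gapm_hom P Q) (g : gapm_hom N P)
    (h : gapm_hom M N) :
  gapm_compose f (gapm_compose g h) = gapm_compose (gapm_compose f g) h.
Proof. exact: gapm_homP. Qed.

Definition gapmCat : category := Category gapm_idl gapm_idr gapm_assoc.

Definition is_frame (M : gapm) (g h : G) : Prop :=
  h ⪯ g /\ forall g' (le_hg' : h ⪯ g'), g' ⪯ g -> bijective (pm_map M le_hg').

Definition framing_set (M : gapm) (H : set G) : Prop :=
  forall g, exists2 h, H h & is_frame M g h.

Definition finite_type (M : gapm) : Prop :=
  exists2 H : set G, finite_set H & framing_set M H.

Definition finitely_generated_type (M : gapmCat) : Prop :=
  finite_type M /\ forall g, fin_generated (pm_comp M g).

End PersistenceModules.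

(* Main.v *)
From HB Require Import structures.
From mathcomp Require Import all_boot all_algebra.
From mathcomp Require Import boolp classical_sets functions cardinality fsbigop.
Require Import Defs.

Set Implicit Arguments.
Unset Strict Implicit.
Unset Printing Implicit Defensive.

Import GRing.Theory.

Local Open Scope classical_set_scope.
Local Open Scope ring_scope.

(** A graded module determines a persistence module: its components are the
    homogeneous parts M_g, on which r in R acts as r X^0, and the structure map
    from g to h + g is multiplication by X^h; since the monoid N^k is
    cancellative, h is determined by the two degrees. Conversely the direct sum
    of the components of a persistence module becomes an R[G]-module when r X^h
    acts on degree g as r times the structure map to h + g. These constructions
    are inverse to each other on the nose, because neither changes the
    underlying family of abelian groups ([gr_ofK], [pm_ofK]), and a graded
    morphism is the same thing as its family of homogeneous parts
    ([pm_of_homK], [gr_of_homK]). So the first construction is a fully faithful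
    functor that is bijective on objects, and such a functor is an isomorphism
    of categories, also between full subcategories that it matches
    ([isomorphic_full_subcategory]).

    It remains to match the two finiteness conditions. Both are equivalent to
    the existence of a finite list of homogeneous elements whose translates
    span every component over R ([generated_by]).

    If there is a finite framing set H and every component is finitely
    generated, then generators of the components of degree in H suffice: each
    element of degree g is the image of one whose degree is a frame of g in H.

    Conversely, let s be a finite list of homogeneous generators. Capping every
    coordinate of a degree g at a large N gives a frame of g. The structure map
    from there to any degree below g is onto once N bounds the degrees of the
    generators, since then no generator is born in between ([span_cap_surj]).
    For injectivity ([span_cap_inj]) list the generators as t :: s'. In degree
    g, the coefficients r for which r t lies in the span of s' form an ideal of
    R, and these ideals grow with g. As R is Noetherian, a monotone family of
    ideals indexed by N^k takes all its values at degrees capped at some N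
    ([ideal_family_stable]). Hence a relation between the generators which
    holds in degree g already holds in the capped degree; peeling the
    generators off one at a time, an element of the kernel turns out to lie in
    the span of the empty list. This argument replaces the Hilbert basis
    theorem by its combinatorial core. *)

(** * Fully faithful functors that are bijective on objects *)

Section HomCast.
Variable C : category.

(** Equality of functors compares morphisms between objects that are only
    propositionally equal, so morphisms have to be transported. *)
Definition hcast (a a' b b' : C) (ea : a = a') (eb : b = b') (f : hom a b) :
    hom a' b' :=
  match ea in _ = x, eb in _ = y return hom x y with erefl, erefl => f end.

Lemma hcast_id (a b : C) (ea : a = a) (eb : b = b) (f : hom a b) :
  hcast ea eb f = f.
Proof. by rewrite (Prop_irrelevance ea erefl) (Prop_irrelevance eb erefl). Qed.

Lemma hcastK (a a' b b' : C) (ea : a = a') (eb : b = b') (ea' : a' = a)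
  (eb' : b' = b) (f : hom a b) : hcast ea' eb' (hcast ea eb f) = f.
Proof. by case: _ / ea ea'; case: _ / eb eb' => *; exact: hcast_id. Qed.

Lemma hcast_idm (a a' : C) (e e' : a = a') : hcast e e' (idm a) = idm a'.
Proof. by case: _ / e e' => e; exact: hcast_id. Qed.

Lemma hcast_comp (a a' b b' c c' : C) (ea : a = a') (eb : b = b') (ec : c = c')
  (f : hom b c) (g : hom a b) :
  hcast ea ec (comp f g) = comp (hcast eb ec f) (hcast ea eb g).
Proof. by case: _ / ea; case: _ / eb; case: _ / ec. Qed.

End HomCast.

Section CastFunctor.
Variables (C D : category).

Lemma fmap_hcast (F : functor C D) (a a' b b' : C) (ea : a = a') (eb : b = b')
    (ea' : F a = F a') (eb' : F b = F b') (f : hom a b) :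
  fmap F (hcast ea eb f) = hcast ea' eb' (fmap F f).
Proof.
case: _ / ea ea' => ea'; case: _ / eb eb' => eb'.
by rewrite [RHS]hcast_id.
Qed.

Lemma functor_ext (F F' : functor C D) (e : forall a, F a = F' a) :
  (forall a b (f : hom a b), hcast (e a) (e b) (fmap F f) = fmap F' f) ->
  F = F'.
Proof.
case: F F' e => [o m mi mc] [o' m' mi' mc'] /= e me.
have oo' : o = o' by apply/funext => a.
case: _ / oo' m' mi' mc' e me => m' mi' mc' e me.
have mm' : m = m'.
  apply: functional_extensionality_dep => a.
  apply: functional_extensionality_dep => b.
  by apply/funext => f; rewrite -me hcast_id.
case: _ / mm' mi' mc' {me} => mi' mc'.
by congr Functor; apply: Prop_irrelevance.
Qed.

End CastFunctor.

Section FullyFaithful.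
Variables (C D : category) (F : functor C D).
Variables (E : D -> C) (Finv : forall a b, hom (F a) (F b) -> hom a b).
Hypotheses (EF : forall a, E (F a) = a) (FE : forall b, F (E b) = b).
Hypothesis FinvK : forall a b, cancel (fmap F (a := a) (b := b)) (@Finv a b).
Hypothesis FK : forall a b, cancel (@Finv a b) (fmap F (a := a) (b := b)).

Let fmapE b b' (f : hom b b') : hom (E b) (E b') :=
  Finv (hcast (esym (FE b)) (esym (FE b')) f).

Fact inverse_id b : fmapE (idm b) = idm (E b).
Proof. by apply: (can_inj (@FinvK _ _)); rewrite FK fmap_id hcast_idm. Qed.

Fact inverse_comp a b c (f : hom b c) (g : hom a b) :
  fmapE (comp f g) = comp (fmapE f) (fmapE g).
Proof.
apply: (can_inj (@FinvK _ _)); rewrite fmap_comp !FK.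
exact: hcast_comp.
Qed.

Definition inverse_functor : functor D C := Functor inverse_id inverse_comp.

(** Applying the faithful functor F turns every equation between transported
    morphisms of C into one of D, where the transports along [FE] cancel. *)
Lemma isomorphic_of_fully_faithful : isomorphic C D.
Proof.
exists F, inverse_functor; split.
- apply: (@functor_ext _ _ (functor_comp inverse_functor F) (functor_id C)
    EF) => a b f /=.
  apply: (can_inj (@FinvK _ _)).
  by rewrite (fmap_hcast _ _ (FE (F a)) (FE (F b))) FK hcastK.
- apply: (@functor_ext _ _ (functor_comp F inverse_functor) (functor_id D)
    FE) => a b f /=.
  by rewrite FK hcastK.
Qed.

End FullyFaithful.

Section Restriction.
Variables (C D : category) (F : functor C D).
Variables (E : D -> C) (Finv : forall a b, hom (F a) (F b) -> hom a b).
Hypotheses (EF : forall a, E (F a) = a) (FE : forall b, F (E b) = b).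
Hypothesis FinvK : forall a b, cancel (fmap F (a := a) (b := b)) (@Finv a b).
Hypothesis FK : forall a b, cancel (@Finv a b) (fmap F (a := a) (b := b)).
Variables (P : C -> Prop) (Q : D -> Prop).
Hypothesis PQ : forall a, P a <-> Q (F a).

Let F' : functor (full_subcategory P) (full_subcategory Q) :=
  @Functor (full_subcategory P) (full_subcategory Q)
    (fun a => exist Q (F (sval a)) ((PQ (sval a)).1 (svalP a)))
    (fun a b f => fmap F f) (fun a => fmap_id F (sval a))
    (fun a b c f g => fmap_comp F f g).

(** The inverse maps on objects and morphisms restrict to the subcategories,
    because P and Q correspond under F. *)
Lemma isomorphic_full_subcategory :
  isomorphic (full_subcategory P) (full_subcategory Q).
Proof.
have PE b (Qb : Q b) : P (E b) by apply/PQ; rewrite FE.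
pose E' (b : full_subcategory Q) : full_subcategory P :=
  exist P (E (sval b)) (PE _ (svalP b)).
apply: (@isomorphic_of_fully_faithful _ _ F' E' (fun a b f => Finv f)).
- by case=> a Pa; apply: eq_exist; exact: EF.
- by case=> b Qb; apply: eq_exist; exact: FE.
- by move=> a b; exact: FinvK.
- by move=> a b; exact: FK.
Qed.

End Restriction.

(** * Modules as abelian groups with a scaling *)

(** The objects of the two categories contain bundled structures, and the round
    trips unbundle and rebundle them. The lemmas of this part show that nothing
    is lost on the way. *)
Section Repack.
Variable R : comPzRingType.

(** A named copy of the underlying type: the unification hints that find the
    group structure of a type need a head constant. *)
Definition carrier (Z : zmodType) : Type := Z.
HB.instance Definition _ (Z : zmodType) := GRing.Zmodule.copy (carrier Z) Z.

Local Notation scaling Z := (GRing.Zmodule_isLmodule R (carrier Z)).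

Definition lmod_of (Z : zmodType) (s : scaling Z) : lmodType R :=
  HB.pack (carrier Z) s.

Definition zmod_of (V : lmodType R) : zmodType := V.

Definition scaling_of (V : lmodType R) : scaling (zmod_of V) :=
  @GRing.Zmodule_isLmodule.Build R (carrier (zmod_of V))
    (fun a (x : V) => a *: x) (@scalerA R V) (@scale1r R V) (@scalerDr R V)
    (fun v a b => @scalerDl R V v a b).

Lemma scaling_eq (S : pzRingType) T ch eq opp zero add i um ma sg
    (s s' :
      @GRing.Zmodule_isLmodule.axioms_ S T ch eq opp zero add i um ma sg) :
    (forall a x, GRing.Zmodule_isLmodule.scale s a x =
                 GRing.Zmodule_isLmodule.scale s' a x) ->
  s = s'.
Proof.
move=> ss'; have {}ss' : GRing.Zmodule_isLmodule.scale s =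
    GRing.Zmodule_isLmodule.scale s'.
  by apply/funext => a; apply/funext => x; apply: ss'.
case: s s' ss' => [c A O Dr Dl] [c' A' O' Dr' Dl'] /= cc'.
case: _ / cc' A' O' Dr' Dl' => A' O' Dr' Dl'.
by congr GRing.Zmodule_isLmodule.Axioms_; apply: Prop_irrelevance.
Qed.

Lemma lmod_of_zmod_of (V : lmodType R) : lmod_of (scaling_of V) = V.
Proof.
case: V => T [opp zero add i um ma ch eq sg s].
apply: (f_equal (fun m => GRing.Lmodule.Pack (GRing.Lmodule.Class i m))).
have mixin_eq (m m' : GRing.Nmodule_isLSemiModule.axioms_ R T zero add um ma
      ch eq sg) :
    GRing.Nmodule_isLSemiModule.scale m =
    GRing.Nmodule_isLSemiModule.scale m' -> m = m'.
  case: m m' => [c A Z O Dr Dl] [c' A' Z' O' Dr' Dl'] /= cc'.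
  case: _ / cc' A' Z' O' Dr' Dl' => A' Z' O' Dr' Dl'.
  by congr GRing.Nmodule_isLSemiModule.Axioms_; apply: Prop_irrelevance.
exact: mixin_eq.
Qed.

(** A bundle is convertible to its repacking only when it is explicitly a
    constructor application; this lemma and the next bring whole families of
    bundles into that form. *)
Lemma zmod_familyP (I : Type) (Z : I -> zmodType) :
  Z = fun i => GRing.Zmodule.Pack (GRing.Zmodule.class (Z i)).
Proof. by apply/funext => i; case: (Z i). Qed.

Lemma lmod_family_ind (I : Type) (Q : (I -> lmodType R) -> Prop) :
  (forall (T : I -> Type) (c : forall i, GRing.Zmodule.axioms_ (T i))
      (s : forall i,
        GRing.Zmodule_isLmodule R (carrier (GRing.Zmodule.Pack (c i)))),
    Q (fun i => lmod_of (s i))) ->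
  forall V, Q V.
Proof.
move=> QT V; have -> : V = fun i => lmod_of (scaling_of (V i)).
  by apply/funext => i; rewrite lmod_of_zmod_of.
exact: (QT (fun i => V i) (fun i => GRing.Zmodule.class (zmod_of (V i)))).
Qed.

Lemma morph_add0 (U V : zmodType) (f : U -> V) :
  {morph f : x y / x + y} -> f 0 = 0.
Proof. by move=> fD; apply: (addIr (f 0)); rewrite -fD !add0r. Qed.

End Repack.

(** * The persistence module of a graded module *)

Section Graded.
Variables (R : comPzRingType) (G : nmodType).
Variable M : gradedModule R G.

Definition gr_in g (x : gr_comp M g) : gr_tot M := dsum_inj x.

(** Multiplication by r X^h from degree g to degree g'. The target degree is a
    parameter of its own, meaningful when it is h + g, so that equal degrees
    need not be convertible. *)
Definition gr_act (r : R) (h g g' : G) (x : gr_comp M g) : gr_comp M g' :=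
  (monom r h *: gr_in x) g'.

Lemma gr_inD g : {morph @gr_in g : x y / x + y}.
Proof. exact: dsum_injD. Qed.

Lemma gr_inK g (x : gr_comp M g) : gr_in x g = x.
Proof. exact: dsum_inj_in. Qed.

Lemma gr_totD (x y : gr_tot M) g : (x + y) g = x g + y g.
Proof. by []. Qed.

Lemma gr_actE r h g g' (x : gr_comp M g) :
  h + g = g' -> monom r h *: gr_in x = gr_in (gr_act r h g' x).
Proof.
move=> hg; apply: dsumP => j; have [->|jg] := eqVneq j g'.
  by rewrite gr_inK.
rewrite [RHS]dsum_inj_out 1?eq_sym //.
apply: (@gr_graded R G M h g r (gr_in x)); last by rewrite hg.
by move=> i ig; apply: dsum_inj_out; rewrite eq_sym.
Qed.

Lemma gr_actDr r h g g' : {morph @gr_act r h g g' : x y / x + y}.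
Proof. by move=> x y; rewrite /gr_act gr_inD scalerDr. Qed.

Lemma gr_actDl h g g' x :
  {morph (fun r => @gr_act r h g g' x) : r s / r + s}.
Proof. by move=> r s; rewrite /gr_act monomD scalerDl. Qed.

Lemma gr_act1 g x : @gr_act 1 0 g g x = x.
Proof. by rewrite /gr_act scale1r gr_inK. Qed.

Lemma gr_actA r s h k g g' g'' (x : gr_comp M g) : h + g = g' ->
  gr_act s k g'' (gr_act r h g' x) = gr_act (s * r) (k + h) g'' x.
Proof. by move=> hg; rewrite /gr_act -gr_actE // scalerA monomM. Qed.

Lemma gr_ind (P : gr_tot M -> Prop) :
  P 0 -> (forall x y, P x -> P y -> P (x + y)) ->
  (forall g (x : gr_comp M g), P (gr_in x)) -> forall x, P x.
Proof. exact: dsum_ind. Qed.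

Section Scaling.
Variable g : G.
Let sc (r : R) (x : gr_comp M g) : gr_comp M g := gr_act r 0 g x.

Fact gr_scaleA a b v : sc a (sc b v) = sc (a * b) v.
Proof. by rewrite /sc gr_actA ?add0r // addr0. Qed.

Definition gr_scaling : GRing.Zmodule_isLmodule R (carrier (gr_comp M g)) :=
  @GRing.Zmodule_isLmodule.Build R (carrier (gr_comp M g)) sc gr_scaleA
    (@gr_act1 g) (fun r => @gr_actDr r 0 g g)
    (fun v => @gr_actDl 0 g g v).
End Scaling.

Definition pm_of_comp g : lmodType R := lmod_of (gr_scaling g).

Lemma pm_of_scaleE g r (x : pm_of_comp g) : r *: x = gr_act r 0 g x.
Proof. by []. Qed.

Section Map.
Variables (g1 g2 : G) (le12 : preceq g1 g2).
Definition gr_shift : G := sval (cid le12).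
Lemma gr_shiftP : gr_shift + g1 = g2.
Proof. by rewrite /gr_shift; case: cid. Qed.
Definition pm_of_fun (x : pm_of_comp g1) : pm_of_comp g2 :=
  gr_act 1 gr_shift g2 x.
Fact pm_of_fun_linear : linear pm_of_fun.
Proof.
move=> a x y; rewrite /pm_of_fun gr_actDr; congr (_ + _).
rewrite !pm_of_scaleE gr_actA ?add0r // gr_actA ?gr_shiftP //.
by rewrite mul1r mulr1 addr0 add0r.
Qed.
HB.instance Definition _ :=
  GRing.isLinear.Build R (pm_of_comp g1) (pm_of_comp g2) *:%R pm_of_fun
    pm_of_fun_linear.
Definition pm_of_map : {linear pm_of_comp g1 -> pm_of_comp g2} := pm_of_fun.
End Map.

(** Without cancellation, multiplication by different powers X^h could give
    different maps between the same two degrees. *)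
Hypothesis addGI : forall g h h' : G, h + g = h' + g -> h = h'.

Lemma pm_of_mapE g1 g2 (le12 : preceq g1 g2) h x :
  h + g1 = g2 -> pm_of_map le12 x = gr_act 1 h g2 x.
Proof.
move=> hg; suff -> : h = gr_shift le12 by [].
by apply: (addGI (g := g1)); rewrite gr_shiftP.
Qed.

Fact pm_of_map_id g (le_gg : preceq g g) x : pm_of_map le_gg x = x.
Proof. by rewrite (@pm_of_mapE _ _ _ 0) ?add0r // gr_act1. Qed.

Fact pm_of_map_comp g1 g2 g3 (le12 : preceq g1 g2) (le23 : preceq g2 g3)
  (le13 : preceq g1 g3) x :
  pm_of_map le13 x = pm_of_map le23 (pm_of_map le12 x).
Proof.
rewrite (pm_of_mapE _ (h := gr_shift le23 + gr_shift le12)); last first.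
  by rewrite -addrA !gr_shiftP.
by rewrite -[RHS]/(gr_act 1 _ _ (gr_act 1 _ _ _)) gr_actA ?gr_shiftP ?mul1r.
Qed.

Definition pm_of : gapm R G := Gapm pm_of_map_id pm_of_map_comp.

End Graded.

Section GradedHom.
Variables (R : comPzRingType) (G : nmodType).
Hypothesis addGI : forall g h h' : G, h + g = h' + g -> h = h'.
Local Notation pm_of M := (pm_of M addGI).

Section Restrict.
Variables (M N : gradedModule R G) (f : gr_hom M N).

Lemma gr_homE g (x : gr_comp M g) : f (gr_in x) = gr_in (f (gr_in x) g).
Proof.
apply: dsumP => j; have [->|jg] := eqVneq j g; first by rewrite gr_inK.
rewrite [RHS]dsum_inj_out 1?eq_sym //.
apply: (gr_funP f (m := gr_in x) _ jg) => i ig.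
by apply: dsum_inj_out; rewrite eq_sym.
Qed.

Lemma gr_hom_act r h g g' (x : gr_comp M g) : h + g = g' ->
  f (gr_in (gr_act r h g' x)) g' = gr_act r h g' (f (gr_in x) g).
Proof. by move=> hg; rewrite -gr_actE // linearZ gr_homE gr_inK. Qed.

Definition pm_of_hom_fun g (x : pm_of_comp M g) : pm_of_comp N g :=
  f (gr_in x) g.

Fact pm_of_hom_linear g : linear (@pm_of_hom_fun g).
Proof.
move=> a x y; rewrite /pm_of_hom_fun gr_inD linearD gr_totD; congr (_ + _).
by rewrite pm_of_scaleE gr_hom_act ?add0r.
Qed.
HB.instance Definition _ g :=
  GRing.isLinear.Build R (pm_of_comp M g) (pm_of_comp N g) *:%R
    (@pm_of_hom_fun g) (@pm_of_hom_linear g).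

Fact pm_of_hom_natural g1 g2 (le12 : preceq g1 g2) (x : pm_comp (pm_of M) g1) :
  pm_map (pm_of N) le12 (pm_of_hom_fun x) =
  pm_of_hom_fun (pm_map (pm_of M) le12 x).
Proof. exact/esym/gr_hom_act/gr_shiftP. Qed.

Definition pm_of_hom : gapm_hom (pm_of M) (pm_of N) :=
  @GapmHom _ _ (pm_of M) (pm_of N)
    (fun g => (@pm_of_hom_fun g : {linear pm_of_comp M g -> pm_of_comp N g}))
    pm_of_hom_natural.

End Restrict.

Section Extend.
Variables (M N : gradedModule R G) (xi : gapm_hom (pm_of M) (pm_of N)).

Fact gr_of_hom_fin (x : gr_tot M) :
  finite_set [set g | (xi g (x g) : gr_comp N g) != 0].
Proof.
apply: (sub_finite_set _ (dsum_fin x)) => g /=.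
by apply: contra_neq => ->; exact: (raddf0 (xi g)).
Qed.

Definition gr_of_hom_fun (x : gr_tot M) : gr_tot N := DSum (gr_of_hom_fin x).

Lemma gr_of_homD : {morph gr_of_hom_fun : x y / x + y}.
Proof.
by move=> x y; apply: dsumP => g; exact: (raddfD (xi g) (x g) (y g)).
Qed.

Lemma gr_of_hom_in g (x : gr_comp M g) :
  gr_of_hom_fun (gr_in x) = gr_in (xi g x : gr_comp N g).
Proof.
apply: dsumP => j; have [->|jg] := eqVneq j g.
  by rewrite /= !dfwith_in.
rewrite /= !dfwith_out 1?eq_sym //; exact: (raddf0 (xi j)).
Qed.

(** Compatibility with the structure maps gives X^h, and R-linearity gives r. *)
Lemma gapm_hom_act r h g g' (x : gr_comp M g) : h + g = g' ->
  xi g' (gr_act r h g' x) = gr_act r h g' (xi g x : gr_comp N g).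
Proof.
move=> hg; have le : preceq g g' by exists h.
have := pm_funP xi le (r *: (x : pm_of_comp M g)).
rewrite -[LHS]/(pm_of_map N _ _) -[pm_map _ _ _]/(pm_of_map M _ _).
rewrite !(pm_of_mapE addGI _ _ hg) linearZ !pm_of_scaleE.
by rewrite !gr_actA ?add0r // mul1r addr0.
Qed.

Fact gr_of_hom_linear : linear gr_of_hom_fun.
Proof.
move=> p x y; rewrite gr_of_homD; congr (_ + _).
have F0 := morph_add0 gr_of_homD.
elim/dsum_ind: p => [|a b ha hb|h r]; first by rewrite !scale0r.
  by rewrite !scalerDl gr_of_homD ha hb.
elim/gr_ind: x => [|a b ha hb|g x]; first by rewrite !(F0, scaler0).
  by rewrite scalerDr !gr_of_homD scalerDr ha hb.
rewrite -/(monom r h) !gr_of_hom_in !(gr_actE _ _ erefl) gr_of_hom_in.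
by rewrite gapm_hom_act.
Qed.
HB.instance Definition _ :=
  GRing.isLinear.Build (monoid_ring R G) (gr_tot M) (gr_tot N) *:%R
    gr_of_hom_fun gr_of_hom_linear.

Fact gr_of_hom_graded g (x : gr_tot M) :
  summand g x -> summand g (gr_of_hom_fun x).
Proof. by move=> gx j jg /=; rewrite gx //; exact: (raddf0 (xi j)). Qed.

Definition gr_of_hom : gr_hom M N :=
  @GrHom _ _ M N (gr_of_hom_fun : {linear gr_tot M -> gr_tot N})
    gr_of_hom_graded.

End Extend.

Lemma pm_of_homK M N : cancel (@pm_of_hom M N) (@gr_of_hom M N).
Proof.
move=> f; apply: gr_homP => x /=; elim/gr_ind: x => [|x y hx hy|g x].
- by rewrite !raddf0.
- by rewrite gr_of_homD hx hy raddfD.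
- by rewrite gr_of_hom_in -gr_homE.
Qed.

Lemma gr_of_homK M N : cancel (@gr_of_hom M N) (@pm_of_hom M N).
Proof.
move=> xi; apply: gapm_homP => g x.
rewrite -[LHS]/(gr_of_hom_fun xi (gr_in (x : gr_comp M g)) g).
by rewrite gr_of_hom_in gr_inK.
Qed.

Fact pm_of_hom_id (M : gradedCat R G) :
  pm_of_hom (idm M) = idm (pm_of M : gapmCat R G).
Proof. by apply: gapm_homP => g x; exact: gr_inK. Qed.

Fact pm_of_hom_comp (M N P : gradedCat R G) (f : hom N P) (f' : hom M N) :
  pm_of_hom (comp f f') =
  comp (pm_of_hom f : @hom (gapmCat R G) (pm_of N) (pm_of P)) (pm_of_hom f').
Proof.
apply: gapm_homP => g x.
rewrite -[LHS]/(f (f' (gr_in (x : gr_comp M g))) g).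
by rewrite gr_homE.
Qed.

Definition pm_functor : functor (gradedCat R G) (gapmCat R G) :=
  @Functor (gradedCat R G) (gapmCat R G) (fun M => pm_of M)
    (fun M N f => pm_of_hom f) pm_of_hom_id pm_of_hom_comp.

End GradedHom.

(** * The graded module of a persistence module *)

Section TotalModule.
Variables (R : comPzRingType) (G : nmodType) (P : gapm R G).
Local Notation RG := (monoid_ring R G).

Definition tot_comp (g : G) : zmodType := zmod_of (pm_comp P g).

Definition tot_in g (m : pm_comp P g) : dsum tot_comp :=
  dsum_inj (M := tot_comp) (i := g) m.

Lemma tot_inD g : {morph @tot_in g : m n / m + n}.
Proof. exact: (@dsum_injD G tot_comp g). Qed.

Lemma preceq_addl (h g : G) : preceq g (h + g).
Proof. by exists h. Qed.

Definition tot_shift (r : R) (h g : G) (m : tot_comp g) : dsum tot_comp :=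
  tot_in (r *: pm_map P (preceq_addl h g) m).

Fact tot_shiftD r h g : {morph @tot_shift r h g : m n / m + n}.
Proof.
move=> m n; rewrite /tot_shift -tot_inD -scalerDr; congr (tot_in (_ *: _)).
exact: (raddfD (pm_map P (preceq_addl h g))).
Qed.

Definition tot_act (r : R) (h : G) : dsum tot_comp -> dsum tot_comp :=
  dsum_lift (@tot_shift r h).

Fact tot_actDr r h : {morph tot_act r h : x y / x + y}.
Proof. by move=> x y; apply: dsum_liftD => g; exact: tot_shiftD. Qed.

Fact tot_act_in r h g (m : tot_comp g) :
  tot_act r h (tot_in m) = tot_shift r h m.
Proof. by rewrite /tot_act dsum_lift_inj // => i; exact: tot_shiftD. Qed.

Fact tot_actDl h x : {morph (fun r => tot_act r h x) : r s / r + s}.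
Proof.
move=> r s; elim/dsum_ind: x => [|x y hx hy|g m].
- by rewrite !(morph_add0 (@tot_actDr _ _)) addr0.
- by rewrite !tot_actDr hx hy addrACA.
- by rewrite !tot_act_in /tot_shift scalerDl tot_inD.
Qed.

Definition tot_scale (p : RG) (x : dsum tot_comp) : dsum tot_comp :=
  dsum_lift (fun h (r : R) => tot_act r h x) p.

Lemma tot_scaleDl x : {morph tot_scale^~ x : p q / p + q}.
Proof. by move=> p q; apply: dsum_liftD => h; exact: tot_actDl. Qed.

Lemma tot_scale_monom r h x : tot_scale (monom r h) x = tot_act r h x.
Proof. by rewrite /tot_scale dsum_lift_inj // => i; exact: tot_actDl. Qed.

Lemma tot_scale0l x : tot_scale 0 x = 0.
Proof. exact: (morph_add0 (@tot_scaleDl x)). Qed.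

Lemma tot_scaleDr : right_distributive tot_scale +%R.
Proof.
move=> p x y; elim/dsum_ind: p => [|p q hp hq|h r].
- by rewrite !tot_scale0l addr0.
- by rewrite !tot_scaleDl hp hq addrACA.
- by rewrite !tot_scale_monom tot_actDr.
Qed.

Lemma tot_scale0r p : tot_scale p 0 = 0.
Proof. exact: (morph_add0 (@tot_scaleDr p)). Qed.

(** The target degree g' is only required to equal h + g, because the two sides
    of associativity land in the degrees (h + k) + g and h + (k + g), which are
    not convertible. *)
Lemma tot_scale_in r h g g' (le : preceq g g') (m : pm_comp P g) :
  h + g = g' -> tot_scale (monom r h) (tot_in m) = tot_in (r *: pm_map P le m).
Proof.
move=> hg; rewrite tot_scale_monom tot_act_in /tot_shift.
by case: _ / hg le => le; rewrite (Prop_irrelevance le (preceq_addl h g)).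
Qed.

Fact tot_scaleA p q x : tot_scale p (tot_scale q x) = tot_scale (p * q) x.
Proof.
elim/dsum_ind: p => [|p p' hp hp'|h r]; first by rewrite mul0r !tot_scale0l.
  by rewrite mulrDl !tot_scaleDl hp hp'.
elim/dsum_ind: q => [|q q' hq hq'|k s].
- by rewrite mulr0 !tot_scale0l tot_scale0r.
- by rewrite mulrDr !tot_scaleDl tot_scaleDr hq hq'.
elim/dsum_ind: x => [|x x' hx hx'|g m]; first by rewrite !tot_scale0r.
  by rewrite !tot_scaleDr hx hx'.
rewrite -/(monom r h) -/(monom s k) -/(tot_in m) monomM.
have le : preceq g (h + (k + g)) by exists (h + k); rewrite addrA.
rewrite (tot_scale_in _ (preceq_addl k g)) //.
rewrite (tot_scale_in _ (preceq_addl h (k + g))) //.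
rewrite (tot_scale_in _ le) ?addrA // linearZ scalerA.
by rewrite (pm_map_comp (preceq_addl k g) (preceq_addl h (k + g)) le).
Qed.

Fact tot_scale1 : left_id 1 tot_scale.
Proof.
move=> x; elim/dsum_ind: x => [|x x' hx hx'|g m].
- exact: tot_scale0r.
- by rewrite tot_scaleDr hx hx'.
have le : preceq g g by exists 0; rewrite add0r.
by rewrite (tot_scale_in _ le) ?add0r // scale1r pm_map_id.
Qed.

Definition tot_struct :=
  @GRing.Zmodule_isLmodule.Build RG (dsum tot_comp) tot_scale
    tot_scaleA tot_scale1 tot_scaleDr tot_scaleDl.

Fact tot_graded g1 g2 r (m : dsum_lmod tot_struct) :
  summand g2 m -> summand (g1 + g2) (monom r g1 *: m).
Proof.
move=> m2; have -> : m = tot_in (m g2).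
  apply: dsumP => g; have [->|gg2] := eqVneq g g2.
    by rewrite [RHS]dsum_inj_in.
  by rewrite m2 // [RHS]dsum_inj_out // eq_sym.
move=> j jg.
rewrite -[_ *: _]/(tot_scale (monom r g1) (tot_in (m g2))).
by rewrite (tot_scale_in _ (preceq_addl g1 g2)) // [LHS]dsum_inj_out 1?eq_sym.
Qed.

Definition gr_of : gradedModule R G := GradedModule tot_graded.

End TotalModule.

(** * The two constructions are mutually inverse *)

Section RoundTrips.
Variables (R : comPzRingType) (G : nmodType).
Hypothesis addGI : forall g h h' : G, h + g = h' + g -> h = h'.

Lemma gradedModule_eq Z
    (s s' : GRing.Zmodule_isLmodule (monoid_ring R G) (dsum Z))
    sP sP' :
  s = s' -> @GradedModule R G Z s sP = @GradedModule R G Z s' sP'.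
Proof.
move=> ss'; case: _ / ss' sP' => sP'.
by congr GradedModule; apply: Prop_irrelevance.
Qed.

(** Once the family of groups is in constructor form, both modules have
    convertible components, and it suffices to compare the actions of r X^h on
    a homogeneous element: X^h followed by r X^0 is r X^h. *)
Lemma gr_ofK (M : gradedModule R G) : gr_of (pm_of M addGI) = M.
Proof.
case: M => Z s sP.
move: s sP; rewrite (zmod_familyP Z).
move: (fun i : G => GRing.Zmodule.class (Z i)) => c s sP.
set M := GradedModule sP.
apply: gradedModule_eq; apply: scaling_eq => p x.
rewrite -[LHS]/(tot_scale (P := pm_of M addGI) p x).
rewrite -[RHS]/(p *: (x : gr_tot M)).
elim/dsum_ind: p => [|p q hp hq|h r].
- by rewrite tot_scale0l scale0r.
- by rewrite tot_scaleDl hp hq scalerDl.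
elim/(@dsum_ind _ (gr_comp M)): x => [|x y hx hy|g m].
- by rewrite tot_scale0r scaler0.
- by rewrite tot_scaleDr hx hy scalerDr.
rewrite -/(monom r h).
rewrite -[RHS]/(monom r h *: gr_in m).
rewrite (gr_actE _ _ erefl).
rewrite -[X in tot_scale _ X]/(@tot_in _ _ (pm_of M addGI) g m).
rewrite (@tot_scale_in _ _ (pm_of M addGI) r h g (h + g) (preceq_addl h g)) //.
congr dsum_inj.
rewrite -[pm_map _ _ _]/(pm_of_map M (preceq_addl h g) m).
rewrite (pm_of_mapE addGI _ _ erefl).
rewrite pm_of_scaleE.
by rewrite gr_actA // mulr1 add0r.
Qed.

Lemma gapm_eq (Z : G -> zmodType)
    (s s' : forall g, GRing.Zmodule_isLmodule R (carrier (Z g)))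
    (f : forall g g', preceq g g' -> {linear lmod_of (s g) -> lmod_of (s g')})
    (f' : forall g g', preceq g g' ->
      {linear lmod_of (s' g) -> lmod_of (s' g')}) fi fi' fc fc' :
    (forall g r (x : Z g),
      r *: (x : lmod_of (s g)) = r *: (x : lmod_of (s' g))) ->
    (forall g g' (le : preceq g g') (x : Z g), f g g' le x = f' g g' le x) ->
  @Gapm R G _ f fi fc = @Gapm R G _ f' fi' fc'.
Proof.
move=> ss' ff'; have {}ss' : s = s'.
  apply: functional_extensionality_dep => g.
  by apply: scaling_eq => r x; exact: ss'.
case: _ / ss' f' fi' fc' ff' => f' fi' fc' ff'.
have {}ff' : f = f'.
  do 3!apply: functional_extensionality_dep => ?.
  by apply: linear_eqP => x; exact: ff'.
case: _ / ff' fi' fc' => fi' fc'.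
by congr Gapm; apply: Prop_irrelevance.
Qed.

Lemma pm_ofK (P : gapm R G) : pm_of (gr_of P) addGI = P.
Proof.
case: P => V; elim/lmod_family_ind: V => T c s f fi fc.
set P := Gapm fi fc.
have actE r h g g' (le : preceq g g') (x : pm_comp P g) : h + g = g' ->
    gr_act (M := gr_of P) r h g' x = r *: pm_map P le x.
  move=> hg; rewrite -[LHS]/(tot_scale (P := P) (monom r h) (tot_in x) g').
  by rewrite (tot_scale_in _ le) // [LHS]dsum_inj_in.
apply: (gapm_eq (Z := fun g => GRing.Zmodule.Pack (c g))) => [g r x|g g' le x].
  have le : preceq g g by exists 0; rewrite add0r.
  rewrite -[LHS]/(gr_act (M := gr_of P) r 0 g x).
  by rewrite (actE _ _ _ _ le) ?add0r // pm_map_id.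
rewrite -[LHS]/(gr_act (M := gr_of P) 1 (gr_shift le) g' x).
by rewrite (actE _ _ _ _ le) ?gr_shiftP // scale1r.
Qed.
End RoundTrips.

(** * Monotone families of ideals in a Noetherian ring *)

Section NoetherianFamilies.
Variable R : comPzRingType.
Hypothesis noethR : noetherian R.

(** The union of the chain is an ideal, and its finitely many generators all
    occur at some finite stage. *)
Lemma ideal_chain_stable (J : nat -> set R) :
    (forall n, is_ideal (J n)) -> (forall n, J n `<=` J n.+1) ->
  exists n0, forall n, (n0 <= n)%N -> J n `<=` J n0.
Proof.
move=> idJ incJ.
have leJ m n : (m <= n)%N -> J m `<=` J n.
  by move/subnK <-; elim: (n - m)%N => // d IH r /IH; exact: incJ.
have [|n [v [vJ Jv]]] := noethR (J := [set r | exists n, J n r]).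
  split=> [|x y [m Jx] [n Jy]|a x [n Jx]].
  - by exists 0%N; case: (idJ 0%N).
  - exists (maxn m n); have [_ + _] := idJ (maxn m n); apply.
      exact: leJ (leq_maxl _ _) _ Jx.
    exact: leJ (leq_maxr _ _) _ Jy.
  - by exists n; have [_ _] := idJ n; apply.
have [f fP] := choice vJ.
pose n0 := \max_i f i; exists n0 => m _ r Jr.
have [J0 JD JM] := idJ n0.
have [|c ->] := Jv r; first by exists m.
apply: (big_ind (J n0)) => // i _; apply: JM; apply: leJ (fP i).
exact: leq_bigmax.
Qed.

Variable k : nat.
Local Notation G := {ffun 'I_k -> nat}.

Definition cap (N : nat) (g : G) : G := [ffun i => minn (g i) N].

(** Induction on the number of coordinates that the family depends on. The
    diagonal chain is stationary from some n0 on, which settles the degrees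
    whose relevant coordinates are all at least n0. The other degrees lie in
    one of finitely many slices, where some coordinate is frozen at a value
    below n0; on a slice the family depends on one coordinate less. *)
Lemma ideal_family_stable (J : G -> set R) :
    (forall g, is_ideal (J g)) ->
    (forall g g' : G, (forall i, g i <= g' i)%N -> J g `<=` J g') ->
  exists N, forall g, J g `<=` J (cap N g).
Proof.
pose depends (S : {set 'I_k}) (J : G -> set R) := forall g g' : G,
  (forall i, i \in S -> g i = g' i) -> J g `<=` J g'.
have: depends [set: 'I_k]%SET J.
  by move=> g g' gg'; have -> : g = g' by apply/ffunP => i; exact: gg'.
have [n] := ubnP #|[set: 'I_k]%SET|; move: [set: 'I_k]%SET => S.
elim: n => // n IH in S J *; rewrite ltnS => Sn depJ idJ leJ.
have [n0 Jn0] : exists n0, forall n, (n0 <= n)%N ->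
    J [ffun => n] `<=` J [ffun => n0].
  apply: (@ideal_chain_stable (fun n => J [ffun => n])) => // m.
  by apply: leJ => i; rewrite !ffunE.
pose slice i c (g : G) : G := [ffun j => if j == i then c else g j].
have /choice[f fP] : forall ic : 'I_k * nat, exists N, ic.1 \in S -> forall g,
    J (slice ic.1 ic.2 g) `<=` J (slice ic.1 ic.2 (cap N g)).
  move=> [i c] /=.
  have [iS|_] := boolP (i \in S); last by exists 0%N.
  have [||g|g g' gg'|N NP] := IH (S :\ i) (fun g => J (slice i c g)).
  - by move: Sn; rewrite (cardsD1 i) iS.
  - move=> g g' gg'; apply: depJ => j jS; rewrite !ffunE.
    by case: eqVneq => // ji; apply: gg'; rewrite !inE ji.
  - exact: idJ.
  - by apply: leJ => j; rewrite !ffunE; case: ifP.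
  - by exists N.
(* The cap must not move a coordinate frozen below n0, whence n0 <= N. *)
pose N := maxn n0 (\max_(i < k) \max_(c < n0) f (i, nat_of_ord c)).
exists N => g; have n0N : (n0 <= N)%N by exact: leq_maxl.
have [/existsP[i /andP[iS gi]]|] := boolP [exists i, (i \in S) && (g i < n0)%N].
  have sg : slice i (g i) g = g.
    by apply/ffunP => j; rewrite ffunE; case: eqVneq => [->|].
  move=> r; rewrite -{1}sg => /(fP (i, g i) iS); apply: leJ => j /=.
  rewrite !ffunE; case: eqVneq => [->|_].
    by rewrite leq_min leqnn (leq_trans (ltnW gi)).
  rewrite leq_min geq_minl (leq_trans (geq_minr _ _)) //.
  apply: leq_trans (leq_maxr _ _).
  apply: leq_trans (leq_bigmax i).
  exact: (leq_bigmax (Ordinal gi)).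
rewrite negb_exists => /forallP gS r Jr.
(* g lies below the diagonal point m, hence J g below J at n0. *)
pose m := maxn n0 (\max_i g i).
have Jm : J [ffun => m] r.
  apply: leJ Jr => i; rewrite ffunE; apply: leq_trans (leq_maxr _ _).
  exact: leq_bigmax.
have {}Jm := Jn0 m (leq_maxl _ _) r Jm.
have: J [ffun i => if i \in S then n0 else 0%N] r.
  by apply: depJ Jm => i iS; rewrite !ffunE iS.
apply: leJ => i; rewrite !ffunE; case: ifP => // iS.
by have := gS i; rewrite iS /= -leqNgt leq_min n0N andbT.
Qed.

End NoetherianFamilies.

(** * Spans of translates of homogeneous elements *)

Section HomogeneousSpan.
Variables (R : comPzRingType) (G : nmodType) (P : gapm R G).
Local Notation gen := {g : G & pm_comp P g}.

Lemma preceq_trans (g2 g1 g3 : G) :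
  preceq g1 g2 -> preceq g2 g3 -> preceq g1 g3.
Proof. by move=> [h <-] [h' <-]; exists (h' + h); rewrite addrA. Qed.

Lemma preceq_refl (g : G) : preceq g g.
Proof. by exists 0; rewrite add0r. Qed.

(** The translate of a homogeneous element to degree g, or 0 if its own degree
    is not below g. *)
Definition push (g : G) (t : gen) : pm_comp P g :=
  if pselect (preceq (tag t) g) is left le then pm_map P le (tagged t) else 0.

Lemma pushE g (t : gen) (le : preceq (tag t) g) :
  push g t = pm_map P le (tagged t).
Proof.
by rewrite /push; case: pselect => // le'; rewrite (Prop_irrelevance le le').
Qed.

Lemma push0 g (t : gen) : ~ preceq (tag t) g -> push g t = 0.
Proof. by rewrite /push; case: pselect. Qed.

Lemma map_push g g' (le : preceq g g') (t : gen) : preceq (tag t) g ->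
  pm_map P le (push g t) = push g' t.
Proof.
move=> tg; rewrite (pushE tg) (pushE (preceq_trans tg le)).
by rewrite (pm_map_comp tg le).
Qed.

(** Membership in the R-span of the translates of s, by recursion on s: this
    exposes one generator at a time, as needed to control the relations. *)
Fixpoint span (s : seq gen) (g : G) (m : pm_comp P g) : Prop :=
  if s is t :: s' then exists r : R, span s' (m - r *: push g t) else m = 0.

Lemma span0 s g : span s (0 : pm_comp P g).
Proof. by elim: s => //= t s IH; exists 0; rewrite scale0r subr0. Qed.

Lemma spanD s g (m n : pm_comp P g) : span s m -> span s n -> span s (m + n).
Proof.
elim: s m n => [|t s IH] m n /=; first by move=> -> ->; rewrite addr0.
move=> [r mr] [r' nr]; exists (r + r').
by rewrite scalerDl opprD addrACA; exact: IH.
Qed.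

Lemma spanZ s g a (m : pm_comp P g) : span s m -> span s (a *: m).
Proof.
elim: s m => [|t s IH] m /=; first by move=> ->; rewrite scaler0.
by move=> [r mr]; exists (a * r); rewrite -scalerA -scalerBr; exact: IH.
Qed.

Lemma span_cons t s g (m : pm_comp P g) : span s m -> span (t :: s) m.
Proof. by move=> ms; exists 0; rewrite scale0r subr0. Qed.

Lemma span_push t s g : span (t :: s) (push g t).
Proof. by exists 1; rewrite scale1r subrr; exact: span0. Qed.

Lemma span_catl s s' g (m : pm_comp P g) : span s m -> span (s ++ s') m.
Proof.
elim: s m => [|t s IH] m /=; first by move=> ->; exact: span0.
by move=> [r mr]; exists r; exact: IH.
Qed.

Lemma span_catr s s' g (m : pm_comp P g) : span s' m -> span (s ++ s') m.
Proof. by elim: s => //= t s IH ms'; apply: span_cons; exact: IH. Qed.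

Lemma span_map s g g' (le : preceq g g') (m : pm_comp P g) :
  span s m -> span s (pm_map P le m).
Proof.
elim: s m => [|t s IH] m /=; first by move=> ->; rewrite raddf0.
move=> [r]; have [tg|tg] := pselect (preceq (tag t) g).
  move=> /IH; rewrite linearB linearZ => mr.
  by exists r; rewrite -(map_push le tg).
rewrite (push0 tg) scaler0 subr0 => /IH mr.
by exists 0; rewrite scale0r subr0.
Qed.

Lemma span_sum s g (m : pm_comp P g) : span s m ->
  exists c : 'I_(size s) -> R,
    m = \sum_i c i *: push g (tnth (in_tuple s) i).
Proof.
elim: s m => [|t s IH] m /=.
  by move=> ->; exists (fun=> 0); rewrite big_ord0.
move=> [r /IH[c mE]].
exists (fun i => if unlift ord0 i is Some j then c j else r).
rewrite big_ord_recl unlift_none -[LHS](subrK (r *: push g t)) mE addrC.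
congr (_ + _); apply: eq_bigr => i _; rewrite liftK.
by congr (_ *: push g _); rewrite !(tnth_nth t).
Qed.

Definition generated_by (s : seq gen) : Prop :=
  forall g (m : pm_comp P g), span s m.

Lemma span_family h n (v : 'I_n -> pm_comp P h) :
  exists s, forall g (le : preceq h g) (c : 'I_n -> R),
    span s (pm_map P le (\sum_i c i *: v i)).
Proof.
elim: n v => [|n IH] v.
  by exists [::] => g le c; rewrite big_ord0; exact: raddf0.
have [s sP] := IH (fun i => v (lift ord0 i)).
exists (Tagged (pm_comp P) (v ord0) :: s) => g le c.
rewrite big_ord_recl linearD; apply: spanD; last exact/span_cons/sP.
rewrite linearZ; apply: spanZ.
by rewrite -(pushE (t := Tagged (pm_comp P) (v ord0))); exact: span_push.
Qed.

(** Every element is the image of an element whose degree is a frame of its own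
    degree, so generators of the finitely many frame components suffice. *)
Lemma generated_of_finitely_generated_type :
  finitely_generated_type P -> exists s, generated_by s.
Proof.
move=> [[H /finite_seqP[hs ->] frameH] fgP].
have [s sP] : exists s, forall h, h \in hs -> forall g (le : preceq h g) m,
    span s (pm_map P le m).
  elim: hs {frameH} => [|h hs [s sP]]; first by exists [::].
  have [n [v vP]] := fgP h; have [s' s'P] := span_family v.
  exists (s' ++ s) => h'; rewrite inE => /predU1P[->|hh'] g le m.
    by have [c ->] := vP m; apply: span_catl; exact: s'P.
  exact/span_catr/sP.
exists s => g m.
have [h hhs [le /(_ g le (preceq_refl g)) [f _ fK]]] := frameH g.
by rewrite -(fK m); exact: sP.
Qed.

Lemma fin_generated_comp s g : generated_by s -> fin_generated (pm_comp P g).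
Proof.
move=> sP; exists (size s), (fun i => push g (tnth (in_tuple s) i)) => m.
exact: span_sum.
Qed.

End HomogeneousSpan.

(** * Finitely many homogeneous generators give finite type *)

Section FiniteType.
Variables (R : comPzRingType) (k : nat).
Hypothesis noethR : noetherian R.
Local Notation G := {ffun 'I_k -> nat}.

Lemma preceq_ffunP (g g' : G) :
  preceq g g' <-> forall i, (g i <= g' i)%N.
Proof.
split=> [[h <-] i|gg']; first by rewrite ffunE leq_addl.
exists [ffun i => (g' i - g i)%N]; apply/ffunP => i.
by rewrite !ffunE; exact: subnK.
Qed.

Lemma ffun_addIr (g h h' : G) : h + g = h' + g -> h = h'.
Proof.
by move=> /ffunP hg; apply/ffunP => i; have := hg i; rewrite !ffunE => /addIn.
Qed.

Variable P : gapm R G.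
Local Notation gen := {g : G & pm_comp P g}.

Definition degree_le (N : nat) (t : gen) : Prop := forall i, (tag t i <= N)%N.

Lemma preceq_cap N (t : gen) (g : G) : degree_le N t ->
  preceq (tag t) g -> preceq (tag t) (cap N g).
Proof.
move=> tN /preceq_ffunP tg; apply/preceq_ffunP => i.
by rewrite ffunE leq_min tg tN.
Qed.

Lemma preceq_capW (N N' : nat) (g : G) : (N <= N')%N ->
  preceq (cap N g) (cap N' g).
Proof.
move=> NN'; apply/preceq_ffunP => i.
by rewrite !ffunE leq_min geq_minl (leq_trans (geq_minr _ _)).
Qed.

Lemma cap_preceq N (g : G) : preceq (cap N g) g.
Proof. by apply/preceq_ffunP => i; rewrite ffunE geq_minl. Qed.

Lemma cap_mono N (g g' : G) : preceq g g' -> preceq (cap N g) (cap N g').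
Proof.
move=> /preceq_ffunP gg'; apply/preceq_ffunP => i.
by rewrite !ffunE leq_min geq_minr (leq_trans (geq_minl _ _)).
Qed.

Fixpoint degrees_le (N : nat) (s : seq gen) : Prop :=
  if s is t :: s' then degree_le N t /\ degrees_le N s' else True.

Lemma degrees_leW N N' s : (N <= N')%N -> degrees_le N s -> degrees_le N' s.
Proof.
move=> NN'; elim: s => //= t s IH [tN sN]; split; last exact: IH.
by move=> i; exact: leq_trans (tN i) NN'.
Qed.

Lemma degrees_le_ex s : exists N, degrees_le N s.
Proof.
elim: s => [|t s [N sN]]; first by exists 0%N.
exists (maxn (\max_i tag t i) N); split.
  by move=> i; apply: leq_trans (leq_maxl _ _); exact: leq_bigmax.
exact: degrees_leW (leq_maxr _ _) sN.
Qed.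

(** A generator with a translate in degree g already has one in degree h, as
    both its degree and N allow it. *)
Lemma span_cap_surj N s h g (le : preceq h g) (m : pm_comp P g) :
    degrees_le N s -> preceq (cap N g) h -> span s m ->
  exists2 n, span s n & m = pm_map P le n.
Proof.
move=> sN gh; elim: s sN m => [|t s IH] /=.
  by move=> _ m ->; exists 0; rewrite ?raddf0.
move=> [tN sN] m [r /(IH sN)[n ns mE]].
exists (n + r *: push h t).
  by exists r; rewrite addrK.
rewrite linearD linearZ -mE; have [tg|tg] := pselect (preceq (tag t) g).
  rewrite map_push ?subrK //; apply: preceq_trans gh; exact: preceq_cap.
rewrite (push0 tg) scaler0 subr0 push0 ?raddf0 ?scaler0 ?addr0 //.
by move=> th; apply: tg; exact: preceq_trans (le).
Qed.

(** Induction on the generators. If r t + m' (with m' in the span of s) dies in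
    degree g, then there r t lies in the span of s; by stability of the ideals
    of such r, this is so already in degree h, and the induction hypothesis
    applies to r t + m'. *)
Lemma span_cap_inj s : exists N, forall h g (le : preceq h g) (m : pm_comp P h),
  preceq (cap N g) h -> span s m -> pm_map P le m = 0 -> m = 0.
Proof.
elim: s => [|t s [N1 IH]]; first by exists 0%N.
(* In degrees not above that of t the translate of t is 0 and every r would
   qualify; the second condition discards these r, to keep J monotone. *)
pose J (g : G) := [set r | span s (r *: push g t) /\
  (preceq (tag t) g \/ r = 0)].
have [|g g' /preceq_ffunP le r /= [rs tg]|N2 JN] :=
    ideal_family_stable noethR (J := J).
- move=> g; split=> [|x y [xs xg] [ys yg]|a x [xs xg]].
  + by split; [rewrite scale0r; exact: span0|right].
  + split; first by rewrite scalerDl; exact: spanD.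
    case: xg => [|->]; first by left.
    by rewrite add0r.
  + split; first by rewrite -scalerA; exact: spanZ.
    by case: xg => [|->]; [left|right; rewrite mulr0].
- split.
    case: tg => [tg|->]; last by rewrite scale0r; exact: span0.
    by rewrite -(map_push le tg) -linearZ; exact: span_map.
  by case: tg => [tg|]; [left; exact: preceq_trans (le)|right].
have [N3 tN] : exists N, degree_le N t.
  by exists (\max_i tag t i) => i; exact: leq_bigmax.
pose N := maxn N1 (maxn N2 N3).
have N1N : (N1 <= N)%N by exact: leq_maxl.
have N2N : (N2 <= N)%N by rewrite /N maxnCA leq_maxl.
have N3N : (N3 <= N)%N by rewrite /N maxnA leq_maxr.
have {N3N} {}tN : degree_le N t by move=> i; exact: leq_trans (tN i) N3N.
exists N => h g le m gh [r mr] m0.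
suff ms : span s m.
  by apply: IH ms m0; exact: preceq_trans (preceq_capW _ N1N) gh.
suff rs : span s (r *: push h t).
  by rewrite -[m](subrK (r *: push h t)); exact: spanD.
have [tg|tg] := pselect (preceq (tag t) g); last first.
  rewrite push0 ?scaler0; first exact: span0.
  by move=> th; apply: tg; exact: preceq_trans (le).
have th : preceq (tag t) h by apply: preceq_trans gh; exact: preceq_cap.
have Jg : J g r.
  split; last by left.
  rewrite -(map_push le th) -linearZ.
  have -> : r *: push h t = - (m - r *: push h t) + m.
    by rewrite opprB addrC addrCA subrr addr0.
  rewrite linearD m0 addr0; apply: span_map.
  by rewrite -scaleN1r; exact: spanZ.
have [rs [tc|->]] := JN g r Jg; last by rewrite scale0r; exact: span0.
have le' : preceq (cap N2 g) h by apply: preceq_trans gh; exact: preceq_capW.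
by rewrite -(map_push le' tc) -linearZ; exact: span_map.
Qed.

Lemma finite_caps N : finite_set [set h | exists g : G, h = cap N g].
Proof.
apply: (@sub_finite_set _ _ (range (fun f : {ffun 'I_k -> 'I_N.+1} =>
    [ffun i => nat_of_ord (f i)] : G))); last exact/finite_image/finite_finset.
move=> _ [g ->]; exists [ffun i => inord (minn (g i) N)] => //.
by apply/ffunP => i; rewrite !ffunE inordK // ltnS geq_minr.
Qed.

(** For g' between cap N g and g, the capped degree of g' is below cap N g, so
    that both lemmas on capped degrees apply to the map from cap N g to g'. *)
Lemma finitely_generated_type_of_generated (s : seq gen) :
  generated_by s -> finitely_generated_type P.
Proof.
move=> sP; split; last by move=> g; exact: fin_generated_comp sP.
have [N1 inj] := span_cap_inj s; have [N2 sN2] := degrees_le_ex s.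
pose N := maxn N1 N2.
have sN : degrees_le N s by apply: degrees_leW sN2; exact: leq_maxr.
exists [set h | exists g : G, h = cap N g]; first exact: finite_caps.
move=> g; exists (cap N g); first by exists g.
split=> [|g' le g'g]; first exact: cap_preceq.
have capg' : preceq (cap N g') (cap N g) by exact: cap_mono.
have surj m : exists n, pm_map P le n = m.
  by have [n _ ->] := span_cap_surj le sN capg' (sP g' m); exists n.
have [f fP] := choice surj.
exists f => // m; apply/eqP; rewrite -subr_eq0; apply/eqP.
apply: (inj _ _ le) => //; last by rewrite linearB /= fP subrr.
by apply: preceq_trans capg'; apply: preceq_capW; exact: leq_maxl.
Qed.

End FiniteType.

(** * Homogeneous generators of a graded module *)

Section HomogeneousGenerators.
Variables (R : comPzRingType) (G : nmodType).
Hypothesis addGI : forall g h h' : G, h + g = h' + g -> h = h'.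
Variable M : gradedModule R G.
Local Notation P := (pm_of M addGI).
Local Notation gen := {g : G & pm_comp P g}.

Lemma addGI_l (g h h' : G) : g + h = g + h' -> h = h'.
Proof. by rewrite !(addrC g); exact: addGI. Qed.

Lemma scale_monom_coord r h g (x : gr_tot M) :
  (monom r h *: x) (h + g) = gr_act r h (h + g) (x g).
Proof.
have act0 : gr_act r h (h + g) (0 : gr_comp M g) = 0.
  by apply: (morph_add0 (@gr_actDr _ _ M r h g (h + g))).
elim/gr_ind: x => [|x y hx hy|g' x].
- by rewrite scaler0 act0.
- by rewrite scalerDr !gr_totD hx hy gr_actDr.
have [->|gg'] := eqVneq g g'; first by rewrite gr_inK.
rewrite (gr_actE _ _ erefl) [LHS]dsum_inj_out; last first.
  by apply: contra_neq gg' => /addGI_l.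
by rewrite [gr_in _ _]dsum_inj_out // eq_sym.
Qed.

Lemma scale_monom_coord0 r h g (x : gr_tot M) :
  ~ preceq h g -> (monom r h *: x) g = 0.
Proof.
move=> hg; elim/gr_ind: x => [|x y hx hy|g' x].
- by rewrite scaler0.
- by rewrite scalerDr gr_totD hx hy addr0.
rewrite (gr_actE _ _ erefl) [LHS]dsum_inj_out //.
by apply: contra_notN hg => /eqP <-; exists g'; rewrite addrC.
Qed.

(** The R[G]-submodule generated by s: in each degree it is the R-span of the
    translates of s. *)
Definition tspan (s : seq gen) (x : gr_tot M) : Prop :=
  forall g, span s (x g : pm_comp P g).

Lemma tspan0 s : tspan s 0.
Proof. by move=> g; exact: span0. Qed.

Lemma tspanD s x y : tspan s x -> tspan s y -> tspan s (x + y).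
Proof. by move=> xs ys g; exact: spanD. Qed.

Lemma tspanZ s p x : tspan s x -> tspan s (p *: x).
Proof.
move=> xs; elim/dsum_ind: p => [|p q hp hq|h r].
- by rewrite scale0r; exact: tspan0.
- by rewrite scalerDl; exact: tspanD.
move=> g; have [[h' <-]|hg] := pselect (preceq h g); last first.
  by rewrite scale_monom_coord0 //; exact: span0.
rewrite addrC scale_monom_coord.
have le : preceq h' (h + h') by exists h.
have -> : gr_act r h (h + h') (x h') =
    r *: (pm_map P le (x h') : pm_comp P (h + h')).
  rewrite -[pm_map _ _ _]/(pm_of_map M le (x h')).
  by rewrite (pm_of_mapE addGI _ _ erefl) pm_of_scaleE gr_actA // mulr1 add0r.
by apply: spanZ; apply: span_map.
Qed.

Lemma tspan_catl s s' x : tspan s x -> tspan (s ++ s') x.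
Proof. by move=> xs g; exact: span_catl. Qed.

Lemma tspan_catr s s' x : tspan s' x -> tspan (s ++ s') x.
Proof. by move=> xs g; exact: span_catr. Qed.

Lemma tspan_ex x : exists s, tspan s x.
Proof.
elim/gr_ind: x => [|x y [s sx] [s' s'y]|g x].
- by exists [::]; exact: tspan0.
- by exists (s ++ s'); apply: tspanD; [exact: tspan_catl|exact: tspan_catr].
exists [:: Tagged (pm_comp P) (x : pm_comp P g)] => g'.
have [->|gg'] := eqVneq g' g; last first.
  by rewrite [gr_in _ _]dsum_inj_out 1?eq_sym //; exact: span0.
rewrite gr_inK.
have := span_push (Tagged (pm_comp P) (x : pm_comp P g)) [::] g.
by rewrite (pushE (t := Tagged _ _) (preceq_refl g)) pm_map_id.
Qed.

(** The homogeneous parts of finitely many generators are finitely many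
    homogeneous elements, and they generate. *)
Lemma generated_of_fin_generated :
  fin_generated (gr_tot M) -> exists s : seq gen, generated_by s.
Proof.
move=> [n [v vP]].
have [s sv] : exists s, forall i, tspan s (v i).
  elim: n v {vP} => [|n IH] v; first by exists [::] => -[].
  have [s sP] := IH (fun i => v (lift ord0 i)).
  have [s' s'P] := tspan_ex (v ord0).
  exists (s' ++ s) => i; case: (unliftP ord0 i) => [j|] ->.
    exact: tspan_catr.
  exact: tspan_catl.
exists s => g m; rewrite -[m](gr_inK (m : gr_comp M g)).
have [c ->] := vP (gr_in (m : gr_comp M g)).
suff: tspan s (\sum_i c i *: v i) by apply.
apply: big_ind => [|x y|i _]; first exact: tspan0.
  exact: tspanD.
exact: tspanZ.
Qed.

(** A coefficient c of the translate of t to degree g is replaced by the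
    monomial c X^h that carries t to degree g. *)
Lemma fin_generated_of_generated (s : seq gen) :
  generated_by s -> fin_generated (gr_tot M).
Proof.
move=> sP; pose t := tnth (in_tuple s).
exists (size s), (fun i => gr_in (tagged (t i) : gr_comp M (tag (t i)))).
elim/gr_ind => [|x y [c ->] [c' ->]|g x].
- by exists (fun=> 0); rewrite big1 // => i _; rewrite scale0r.
- exists (fun i => c i + c' i); rewrite -big_split; apply: eq_bigr => i _.
  by rewrite scalerDl.
have [c xE] := span_sum (sP g x).
have -> : gr_in x = \sum_i gr_in (c i *: push g (t i) : gr_comp M g).
  rewrite [in LHS]xE.
  apply: (big_morph (fun m : pm_comp P g => gr_in (m : gr_comp M g))).
    exact: gr_inD.
  exact: (morph_add0 (@gr_inD _ _ M g)).
exists (fun i => if pselect (preceq (tag (t i)) g) is left le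
  then monom (c i) (gr_shift le) else 0).
apply: eq_bigr => i _; rewrite /push; case: pselect => [le|_]; last first.
  rewrite scaler0 scale0r; exact: (morph_add0 (@gr_inD _ _ M g)).
rewrite (gr_actE _ _ (gr_shiftP le)); congr dsum_inj.
rewrite -[pm_map _ _ _]/(pm_of_map M le (tagged (t i))).
rewrite (pm_of_mapE addGI _ _ (gr_shiftP le)) pm_of_scaleE.
by rewrite gr_actA ?gr_shiftP // mulr1 add0r.
Qed.

End HomogeneousGenerators.

Theorem corollary21 (R : comPzRingType) (k : nat) (noethR : noetherian R) :
  isomorphic
    (full_subcategory (@gr_fin_generated R {ffun 'I_k -> nat}))
    (full_subcategory (@finitely_generated_type R {ffun 'I_k -> nat})).
Proof.
pose addGI := @ffun_addIr k.
apply: (@isomorphic_full_subcategory _ _ (pm_functor R addGI)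
  (fun P : gapmCat R {ffun 'I_k -> nat} => gr_of P : gradedCat R _)
  (fun M N => @gr_of_hom _ _ addGI M N)).
- exact: gr_ofK.
- exact: pm_ofK.
- exact: pm_of_homK.
- exact: gr_of_homK.
move=> M; split=> [fgM|fgP].
  have [s sP] := generated_of_fin_generated addGI fgM.
  exact: finitely_generated_type_of_generated sP.
have [s sP] := generated_of_finitely_generated_type fgP.
exact: fin_generated_of_generated sP.
Qed.
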